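(* Suppose a sequence of M-stationary points $x^{t}\in M^{\text{D}(t)}$ of $\text{D}(t)$ with multipliers $(\zeta^t,\eta^t,\nu^t)$ converges to $\bar x$ for $t\to 0$. Let MPCC-LICQ and MPCC-ND2 be fulfilled at $\bar x\in M$. Then $\bar x$ is an S-stationary point of MPCC.
   Context: Let $f\in C^2(\mathbb{R}^n,\mathbb{R})$, $F_1,F_2\in C^2(\mathbb{R}^n,\mathbb{R}^\kappa)$. MPCC is the problem $\min f(x)$ s.t. $x\in M$ with $M=\{x\in\mathbb{R}^n \mid F_{1,j}(x)\cdot F_{2,j}(x)=0,\ F_{1,j}(x)\ge 0,\ F_{2,j}(x)\ge 0,\ j=1,\ldots,\kappa\}$. For $t>0$, the disjunctive regularization $\text{D}(t)$ is the problem $\min f(x)$ s.t. $x\in M^{\text{D}(t)}$ with $M^{\text{D}(t)}=\{x\in\mathbb{R}^n \mid \max\{t-F_{1,j}(x),t-F_{2,j}(x)\}\ge 0,\ F_{1,j}(x)\ge 0,\ F_{2,j}(x)\ge 0,\ j=1,\ldots,\kappa\}$. In the claim, $t$ runs through positive parameters tending to $0$. MPCC notions. For $\bar x\in M$: $a_{01}(\bar x)=\{j\mid F_{1,j}(\bar x)=0,F_{2,j}(\bar x)>0\}$, $a_{10}(\bar x)=\{j\mid F_{1,j}(\bar x)>0,F_{2,j}(\bar x)=0\}$, $a_{00}(\bar x)=\{j\mid F_{1,j}(\bar x)=F_{2,j}(\bar x)=0\}$. MPCC-LICQ at $\bar x$: the vectors $\nabla F_{1,j}(\bar x)$, $j\in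 a_{01}(\bar x)\cup a_{00}(\bar x)$, and $\nabla F_{2,j}(\bar x)$, $j\in a_{10}(\bar x)\cup a_{00}(\bar x)$, are linearly independent. $\bar x\in M$ is C-stationary for MPCC if there exist multipliers $\bar\sigma_{1,j}$ ($j\in a_{01}(\bar x)$), $\bar\sigma_{2,j}$ ($j\in a_{10}(\bar x)$), $\bar\varrho_{1,j},\bar\varrho_{2,j}$ ($j\in a_{00}(\bar x)$) with $$\nabla f(\bar x)=\sum_{j\in a_{01}(\bar x)}\bar\sigma_{1,j}\nabla F_{1,j}(\bar x)+\sum_{j\in a_{10}(\bar x)}\bar\sigma_{2,j}\nabla F_{2,j}(\bar x)+\sum_{j\in a_{00}(\bar x)}\left(\bar\varrho_{1,j}\nabla F_{1,j}(\bar x)+\bar\varrho_{2,j}\nabla F_{2,j}(\bar x)\right)$$ and $\bar\varrho_{1,j}\cdot\bar\varrho_{2,j}\ge 0$ for all $j\in a_{00}(\bar x)$. It is S-stationary if, moreover, $\bar\varrho_{1,j}\ge 0$ and $\bar\varrho_{2,j}\ge 0$ for all $j\in a_{00}(\bar x)$. MPCC-ND2 at a C-stationary point $\bar x$ with multipliers $(\bar\sigma,\bar\varrho)$: $\bar\varrho_{1,j}\cdot\bar\varrho_{2,j}>0$ for all $j\in a_{00}(\bar x)$. (Under the convergence hypothesis and MPCC-LICQ, $\bar x$ is C-stationary for MPCC with unique multipliers; MPCC-ND2 refers to these.) $\text{D}(t)$ notions. For $x\in M^{\text{D}(t)}$: $\mathcal{H}_{12}(x)=\{j\mid F_{1,j}(x)=F_{2,j}(x)=t\}$,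 $\mathcal{H}_{1}(x)=\{j\mid F_{1,j}(x)=t,F_{2,j}(x)>t\}$, $\mathcal{H}_{2}(x)=\{j\mid F_{1,j}(x)>t,F_{2,j}(x)=t\}$, $\mathcal{N}_1(x)=\{j\mid F_{1,j}(x)=0\}$, $\mathcal{N}_2(x)=\{j\mid F_{2,j}(x)=0\}$. $x\in M^{\text{D}(t)}$ is M-stationary for $\text{D}(t)$ if there exist multipliers $\zeta_{1,j},\zeta_{2,j}\ge 0$ with $\zeta_{1,j}\cdot\zeta_{2,j}=0$ ($j\in\mathcal{H}_{12}(x)$), $\eta_{1,j}\ge 0$ ($j\in\mathcal{H}_1(x)$), $\eta_{2,j}\ge 0$ ($j\in\mathcal{H}_2(x)$), $\nu_{1,j}\ge 0$ ($j\in\mathcal{N}_1(x)$), $\nu_{2,j}\ge 0$ ($j\in\mathcal{N}_2(x)$) with $$\nabla f(x)=-\sum_{j\in\mathcal{H}_{12}(x)}\left(\zeta_{1,j}\nabla F_{1,j}(x)+\zeta_{2,j}\nabla F_{2,j}(x)\right)-\sum_{j\in\mathcal{H}_1(x)}\eta_{1,j}\nabla F_{1,j}(x)-\sum_{j\in\mathcal{H}_2(x)}\eta_{2,j}\nabla F_{2,j}(x)+\sum_{j\in\mathcal{N}_1(x)}\nu_{1,j}\nabla F_{1,j}(x)+\sum_{j\in\mathcal{N}_2(x)}\nu_{2,j}\nabla F_{2,j}(x).$$ *)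

(* Defs.v *)
From HB Require Import structures.
From mathcomp Require Import all_boot all_order all_algebra.
From mathcomp Require Import all_classical all_reals topology normedtype derive.

Set Implicit Arguments.
Unset Strict Implicit.
Unset Printing Implicit Defensive.
Import Order.TTheory GRing.Theory Num.Theory.
Import numFieldNormedType.Exports.
Local Open Scope ring_scope.

(* Points of R^n are row vectors.  They carry the sup norm, which induces the
   same topology and the same differentiability notion as the Euclidean one. *)

Definition partial (R : realType) (n : nat) (W : normedModType R) (i : 'I_n)
    (g : 'rV[R]_n -> W) : 'rV[R]_n -> W :=
  fun x => 'D_(delta_mx 0 i) g x.

(* Class C^k: Frechet differentiability at every order below k, together with
   continuity of the partial derivatives of order k. *)
Fixpoint is_C (R : realType) (n : nat) (W : normedModType R) (k : nat)
    (g : 'rV[R]_n -> W) : Prop :=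
  if k is k'.+1 then
    (forall x, differentiable g x) /\ (forall i, is_C k' (partial i g))
  else continuous g.

Definition grad (R : realType) (n : nat) (g : 'rV[R]_n -> R) (x : 'rV[R]_n) :
    'rV[R]_n :=
  \row_i partial i g x.

Definition component (R : realType) (n kappa : nat)
    (F : 'rV[R]_n -> 'rV[R]_kappa)
    (j : 'I_kappa) : 'rV[R]_n -> R :=
  fun x => F x 0 j.

(* All multipliers below are total functions of j : 'I_kappa; only their values
   on the relevant index sets are ever constrained or used. *)

Section MPCC.
Variables (R : realType) (n kappa : nat).
Variables (f : 'rV[R]_n -> R) (F1 F2 : 'rV[R]_n -> 'rV[R]_kappa).
Implicit Types x : 'rV[R]_n.

Definition MPCC_feasible x : Prop :=
  forall j, [/\ component F1 j x * component F2 j x = 0,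
                0 <= component F1 j x & 0 <= component F2 j x].

Definition a01 x : {set 'I_kappa} :=
  [set j | (component F1 j x == 0) && (0 < component F2 j x)]%SET.
Definition a10 x : {set 'I_kappa} :=
  [set j | (0 < component F1 j x) && (component F2 j x == 0)]%SET.
Definition a00 x : {set 'I_kappa} :=
  [set j | (component F1 j x == 0) && (component F2 j x == 0)]%SET.

(* Linear independence is that of the indexed family: a gradient occurring
   twice makes the sequence non-free. *)
Definition MPCC_LICQ x : Prop :=
  free ([seq grad (component F1 j) x | j <- enum (a01 x :|: a00 x)%SET] ++
        [seq grad (component F2 j) x | j <- enum (a10 x :|: a00 x)%SET]).

Definition C_stationary_with x (sigma1 sigma2 rho1 rho2 : 'I_kappa -> R) :
    Prop :=
  [/\ MPCC_feasible x,
      grad f x =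
        \sum_(j in a01 x) sigma1 j *: grad (component F1 j) x
        + \sum_(j in a10 x) sigma2 j *: grad (component F2 j) x
        + \sum_(j in a00 x) (rho1 j *: grad (component F1 j) x
                             + rho2 j *: grad (component F2 j) x) &
      forall j, j \in a00 x -> 0 <= rho1 j * rho2 j].

Definition S_stationary x : Prop :=
  exists sigma1 sigma2 rho1 rho2 : 'I_kappa -> R,
    C_stationary_with x sigma1 sigma2 rho1 rho2 /\
    (forall j, j \in a00 x -> 0 <= rho1 j /\ 0 <= rho2 j).

(* ND2 speaks about the multipliers of a C-stationary point, which are unique
   on the index sets under LICQ.  It is phrased for every choice of them, so
   that assuming ND2 does not by itself assume C-stationarity. *)
Definition MPCC_ND2 x : Prop :=
  forall sigma1 sigma2 rho1 rho2 : 'I_kappa -> R,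
    C_stationary_with x sigma1 sigma2 rho1 rho2 ->
    forall j, j \in a00 x -> 0 < rho1 j * rho2 j.

Definition D_feasible (t : R) x : Prop :=
  forall j, [/\ 0 <= Num.max (t - component F1 j x) (t - component F2 j x),
                0 <= component F1 j x & 0 <= component F2 j x].

Definition H12 (t : R) x : {set 'I_kappa} :=
  [set j | (component F1 j x == t) && (component F2 j x == t)]%SET.
Definition H1 (t : R) x : {set 'I_kappa} :=
  [set j | (component F1 j x == t) && (t < component F2 j x)]%SET.
Definition H2 (t : R) x : {set 'I_kappa} :=
  [set j | (t < component F1 j x) && (component F2 j x == t)]%SET.
Definition N1 x : {set 'I_kappa} := [set j | component F1 j x == 0]%SET.
Definition N2 x : {set 'I_kappa} := [set j | component F2 j x == 0]%SET.

Definition M_stationary_with (t : R) x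
    (zeta1 zeta2 eta1 eta2 nu1 nu2 : 'I_kappa -> R) : Prop :=
  [/\ D_feasible t x,
      grad f x =
        - \sum_(j in H12 t x) (zeta1 j *: grad (component F1 j) x
                               + zeta2 j *: grad (component F2 j) x)
        - \sum_(j in H1 t x) eta1 j *: grad (component F1 j) x
        - \sum_(j in H2 t x) eta2 j *: grad (component F2 j) x
        + \sum_(j in N1 x) nu1 j *: grad (component F1 j) x
        + \sum_(j in N2 x) nu2 j *: grad (component F2 j) x,
      forall j, j \in H12 t x ->
        [/\ 0 <= zeta1 j, 0 <= zeta2 j & zeta1 j * zeta2 j = 0],
      (forall j, j \in H1 t x -> 0 <= eta1 j) /\
      (forall j, j \in H2 t x -> 0 <= eta2 j) &
      (forall j, j \in N1 x -> 0 <= nu1 j) /\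
      (forall j, j \in N2 x -> 0 <= nu2 j)].

End MPCC.

(* Main.v *)
Require Import Defs.
From mathcomp Require Import all_boot all_order all_algebra.
From mathcomp Require Import all_classical all_reals topology normedtype derive.
From mathcomp Require Import ring.
Import Order.TTheory GRing.Theory Num.Theory.
Import numFieldNormedType.Exports.
Local Open Scope ring_scope.
Set Implicit Arguments.
Unset Strict Implicit.
Unset Printing Implicit Defensive.

(* At x^t collect, for each j, the total coefficients c_{1,j} and c_{2,j} of
   grad F_{1,j} and grad F_{2,j} in the M-stationarity equation.  For small t
   they vanish wherever the function is positive at xbar, so MPCC-LICQ forces
   them to converge to multipliers at xbar.  Disjunctive feasibility and
   zeta_1 zeta_2 = 0 leave only two possibilities: the product c_{1,j} c_{2,j}
   is zero, or both factors are nonnegative.  Hence the limits are C-stationary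
   multipliers; by MPCC-ND2 their products on a_00 are positive, so for small t
   the first possibility is excluded and the limits are nonnegative. *)

(** * Entrywise limits of matrices, determinants and adjugates *)

Lemma cvg_sumr (R : realType) (T : Type) (F : set_system T) (I : Type)
    (r : seq I) (P : pred I) (u : I -> T -> R) (l : I -> R) :
  Filter F -> (forall i, P i -> (u i x @[x --> F] --> l i)%classic) ->
  ((\sum_(i <- r | P i) u i x) @[x --> F] --> \sum_(i <- r | P i) l i)%classic.
Proof. by move=> FF ul; apply: cvg_big => //; exact: add_continuous. Qed.

Lemma cvg_prodr (R : realType) (T : Type) (F : set_system T) (I : Type)
    (r : seq I) (P : pred I) (u : I -> T -> R) (l : I -> R) :
  Filter F -> (forall i, P i -> (u i x @[x --> F] --> l i)%classic) ->
  ((\prod_(i <- r | P i) u i x) @[x --> F] --> \prod_(i <- r | P i) l i)%classic.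
Proof. by move=> FF ul; apply: cvg_big => //; exact: mul_continuous. Qed.

Definition cvg_entries (R : realType) (m n : nat) (A_ : nat -> 'M[R]_(m, n))
    (A : 'M[R]_(m, n)) : Prop :=
  forall i j, (A_ k i j @[k --> \oo] --> A i j)%classic.

Lemma cvg_entries_mul (R : realType) (m n p : nat)
    (A_ : nat -> 'M[R]_(m, n)) (A : 'M[R]_(m, n))
    (B_ : nat -> 'M[R]_(n, p)) (B : 'M[R]_(n, p)) :
  cvg_entries A_ A -> cvg_entries B_ B ->
  cvg_entries (fun k => A_ k *m B_ k) (A *m B).
Proof.
move=> AA BB i j; rewrite mxE; under eq_fun do rewrite mxE.
by apply: cvg_sumr => l _; apply: cvgM.
Qed.

Lemma cvg_det (R : realType) (n : nat) (A_ : nat -> 'M[R]_n) (A : 'M[R]_n) :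
  cvg_entries A_ A -> (\det (A_ k) @[k --> \oo] --> \det A)%classic.
Proof.
move=> AA; rewrite /determinant; apply: cvg_sumr => s _.
by apply: cvgM; [exact: cvg_cst | apply: cvg_prodr].
Qed.

Lemma cvg_entries_adj (R : realType) (n : nat) (A_ : nat -> 'M[R]_n)
    (A : 'M[R]_n) :
  cvg_entries A_ A -> cvg_entries (fun k => \adj (A_ k)) (\adj A).
Proof.
move=> AA i j; rewrite mxE; under eq_fun do rewrite mxE.
have minor_cvg : (\det (row' j (col' i (A_ k))) @[k --> \oo]
    --> \det (row' j (col' i A)))%classic.
  apply: cvg_det => a b; rewrite !mxE; under eq_fun do rewrite !mxE.
  exact: AA.
exact: (cvgM (cvg_cst _) minor_cvg).
Qed.

Lemma cvg_entries_unique (R : realType) (m n : nat) (A_ : nat -> 'M[R]_(m, n))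
    (A B : 'M[R]_(m, n)) :
  cvg_entries A_ A -> cvg_entries A_ B -> A = B.
Proof.
move=> AA AB; apply/matrixP => i j; apply: cvg_unique (AA i j) (AB i j).
exact: norm_hausdorff.
Qed.

(** * Convergence of coefficients under linear independence *)

(* A right inverse [B] of the limit [A] turns [g_ k = c_ k *m A_ k] into a
   square system whose matrix [A_ k *m B] tends to the identity, and Cramer's
   rule expresses [c_ k] continuously in the data. *)
Lemma row_free_coeffs_cvg (R : realType) (m n : nat)
    (A_ : nat -> 'M[R]_(m, n)) (A : 'M[R]_(m, n))
    (g_ : nat -> 'rV[R]_n) (g : 'rV[R]_n) (c_ : nat -> 'rV[R]_m) :
  row_free A -> cvg_entries A_ A -> cvg_entries g_ g ->
  (\forall k \near \oo, g_ k = c_ k *m A_ k)%classic ->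
  exists2 c, cvg_entries c_ c & g = c *m A.
Proof.
move=> /row_freeP[B AB1] AA gg gE.
have BB : cvg_entries (fun=> B) B by move=> i j; exact: cvg_cst.
have MM := cvg_entries_mul AA BB; rewrite AB1 in MM.
have det1 := cvg_det MM; rewrite det_scalar expr1n in det1.
(* As [\adj 1%:M] is the identity, this limit is just [g *m B]; it is kept in the form in which the
   adjugate formula produces it. *)
have cc : cvg_entries c_ (g *m B *m \adj 1%:M).
  move=> i j.
  have -> : (g *m B *m \adj 1%:M) i j = 1^-1 * (g *m B *m \adj 1%:M) i j.
    by rewrite invr1 mul1r.
  have gBM := cvg_entries_mul (cvg_entries_mul gg BB) (cvg_entries_adj MM).
  apply: (cvg_trans _ (cvgM (cvgV (oner_neq0 _) det1) (gBM i j))).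
  apply: near_eq_cvg.
  near=> k => /=.
  have -> : g_ k = c_ k *m A_ k by near: k.
  rewrite -[c_ k *m A_ k *m B]mulmxA -mulmxA mul_mx_adj mul_mx_scalar mxE.
  rewrite mulKf //; near: k.
  apply: (cvgr_neq0 _ det1); exact: oner_neq0.
exists (g *m B *m \adj 1%:M) => //.
(* The sequence [g_ k] tends to [g] and, being eventually [c_ k *m A_ k], also to the product of the
   limits. *)
apply: cvg_entries_unique gg _ => i j.
have cA := cvg_entries_mul cc AA.
apply: (cvg_trans _ (cA i j)); apply: near_eq_cvg.
by apply: filterS gE => k ->.
Unshelve. all: by end_near. Qed.

(** Stacking the family as matrix rows reduces this to [row_free_coeffs_cvg]. An arbitrary index
    type lets one list hold the gradients of both constraint maps. *)
Lemma free_coeffs_cvg (R : realType) (n : nat) (I : eqType) (s : seq I)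
    (v_ : nat -> I -> 'rV[R]_n) (v : I -> 'rV[R]_n)
    (g_ : nat -> 'rV[R]_n) (g : 'rV[R]_n) (c_ : nat -> I -> R) :
  free [seq v i | i <- s] -> (forall i, cvg_entries (v_^~ i) (v i)) ->
  cvg_entries g_ g ->
  (\forall k \near \oo, g_ k = \sum_(i <- s) c_ k i *: v_ k i)%classic ->
  exists2 c : I -> R,
    {in s, forall i, (c_ k i @[k --> \oo] --> c i)%classic} &
    g = \sum_(i <- s) c i *: v i.
Proof.
move=> vfree vv gg gE.
pose r := tnth (in_tuple s).
pose M (w : I -> 'rV[R]_n) := \matrix_(o < size s) w (r o).
pose C (a : I -> R) := \row_(o < size s) a (r o).
have sumE a w : \sum_(i <- s) a i *: w i = C a *m M w.
  rewrite mulmx_sum_row big_tnth; apply: eq_bigr => o _.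
  by rewrite rowK mxE.
have Mfree : row_free (M v).
  apply: inj_row_free => w wM0; apply/rowP => o; rewrite [RHS]mxE.
  have /freeP : free (map_tuple v (in_tuple s)) by [].
  apply => //.
  rewrite -[RHS]wM0 mulmx_sum_row; apply: eq_bigr => p _.
  by rewrite rowK -tnth_nth tnth_map.
have MM : cvg_entries (fun k => M (v_ k)) (M v).
  move=> o j; rewrite mxE; under eq_fun do rewrite mxE.
  exact: vv.
have [|d dd gd] := @row_free_coeffs_cvg _ _ _ _ _ _ _ (fun k => C (c_ k)) Mfree MM gg.
  by apply: filterS gE => k ->.
have c_d o : (c_ k (r o) @[k --> \oo] --> d 0 o)%classic.
  have := dd 0 o; by under eq_fun do rewrite mxE.
(* Taking [lim] gives a total function of [i] without choosing a position in [s]; its values off [s]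
   do not matter. *)
exists (fun i => lim (c_ k i @[k --> \oo])%classic).
  by move=> i /(tnthP (in_tuple s))[o ->]; apply/cvg_ex; exists (d 0 o); exact: c_d.
rewrite gd sumE; congr (_ *m _); apply/rowP => o.
by rewrite mxE; apply/esym/cvg_lim => //; exact: c_d.
Qed.

(** * Continuity of functions and gradients along the sequence *)

Lemma is_C_cvg (R : realType) (n : nat) (W : normedModType R) (k : nat)
    (g : 'rV[R]_n -> W) (x : nat -> 'rV[R]_n) (xbar : 'rV[R]_n) :
  is_C k g -> (x k @[k --> \oo] --> xbar)%classic ->
  (g (x k) @[k --> \oo] --> g xbar)%classic.
Proof.
move=> gC xx; apply: continuous_cvg => //.
case: k gC => [gC|k [gd _]]; first exact: gC.
exact: differentiable_continuous.
Qed.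

Lemma grad_cvg (R : realType) (n k : nat) (g : 'rV[R]_n -> R)
    (x : nat -> 'rV[R]_n) (xbar : 'rV[R]_n) :
  is_C k.+1 g -> (x k @[k --> \oo] --> xbar)%classic ->
  cvg_entries (fun k => grad g (x k)) (grad g xbar).
Proof.
move=> [_ gC] xx a i; rewrite mxE; under eq_fun do rewrite mxE.
exact: is_C_cvg (gC i) xx.
Qed.

Lemma component_cvg (R : realType) (n kappa k : nat)
    (F : 'rV[R]_n -> 'rV[R]_kappa) (j : 'I_kappa)
    (x : nat -> 'rV[R]_n) (xbar : 'rV[R]_n) :
  is_C k F -> (x k @[k --> \oo] --> xbar)%classic ->
  (component F j (x k) @[k --> \oo] --> component F j xbar)%classic.
Proof.
move=> FC xx.
have ev := @coord_continuous R 1 kappa 0 j (F xbar).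
exact: (cvg_comp _ _ (is_C_cvg FC xx) ev).
Qed.

(** Smoothness is given for the vector-valued [F]; differentiability makes partial derivatives
    commute with coordinates, so continuity of [partial i F] carries over. *)
Lemma grad_component_cvg (R : realType) (n kappa k : nat)
    (F : 'rV[R]_n -> 'rV[R]_kappa) (j : 'I_kappa)
    (x : nat -> 'rV[R]_n) (xbar : 'rV[R]_n) :
  is_C k.+1 F -> (x k @[k --> \oo] --> xbar)%classic ->
  cvg_entries (fun k => grad (component F j) (x k)) (grad (component F j) xbar).
Proof.
move=> [Fd FC] xx a i.
have gradE y : grad (component F j) y a i = component (partial i F) j y.
  rewrite mxE /component /partial derive_mx ?mxE //.
  exact: diff_derivable.
rewrite gradE; under eq_fun do rewrite gradE.
exact: component_cvg (FC i) xx.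
Qed.

(** * Total coefficients at an M-stationary point *)

(* The coefficient of [grad F_{1,j}] in the M-stationarity equation when
   [a = F_{1,j}(x)] and [b = F_{2,j}(x)]; for [grad F_{2,j}], swap [a] and [b]. *)
Definition net_multiplier (R : realType) (t a b zeta eta nu : R) : R :=
  (if a == 0 then nu else 0)
  - (if (a == t) && (b == t) then zeta else 0)
  - (if (a == t) && (t < b) then eta else 0).

Lemma net_multiplier_inactive (R : realType) (t a b zeta eta nu : R) :
  0 < t -> t < a -> net_multiplier t a b zeta eta nu = 0.
Proof.
move=> t0 ta; rewrite /net_multiplier (gt_eqF ta) (gt_eqF (lt_trans t0 ta)).
by rewrite !subr0.
Qed.

Section MultiplierPair.
Variables (R : realType) (n kappa : nat).
Variables (f : 'rV[R]_n -> R) (F1 F2 : 'rV[R]_n -> 'rV[R]_kappa).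
Variables (t : R) (x : 'rV[R]_n) (zeta1 zeta2 eta1 eta2 nu1 nu2 : 'I_kappa -> R).
Hypothesis stat : M_stationary_with f F1 F2 t x zeta1 zeta2 eta1 eta2 nu1 nu2.

Let c1 j := net_multiplier t (component F1 j x) (component F2 j x)
  (zeta1 j) (eta1 j) (nu1 j).
Let c2 j := net_multiplier t (component F2 j x) (component F1 j x)
  (zeta2 j) (eta2 j) (nu2 j).

Lemma M_stationary_grad :
  grad f x = \sum_j c1 j *: grad (component F1 j) x
             + \sum_j c2 j *: grad (component F2 j) x.
Proof.
have mkcond (A : {set 'I_kappa}) r (v : 'I_kappa -> 'rV[R]_n) :
    \sum_(j in A) r j *: v j = \sum_j (if j \in A then r j else 0) *: v j.
  by rewrite big_mkcond; apply: eq_bigr => j _; case: ifP; rewrite ?scale0r.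
case: stat => _ -> _ _ _.
rewrite big_split /= !mkcond opprD -!sumrN -!big_split /=.
apply: eq_bigr => j _; rewrite !inE /c1 /c2 /net_multiplier.
(* [c2] tests [F2] first, whereas [H12] and [H2] test [F1] first; reordering lets the six
   conditional coefficients be abstracted for [ring]. *)
rewrite (andbC (component F2 j x == t)) (andbC (component F2 j x == t) (t < _)).
apply/rowP => l; rewrite !mxE.
do 6! [move: (if _ then _ else _) => ?].
by move: (partial _ _ _) (partial _ _ _) => ? ?; ring.
Qed.

(** If either function vanishes at [x], then [0 < t] removes all [zeta] and [eta] terms, leaving
    only nonnegative [nu] terms. Otherwise a nonzero product would need both functions equal to [t],
    where the product is [zeta1 j * zeta2 j = 0]. *)
Lemma net_multiplier_pair j : 0 < t ->
  c1 j * c2 j = 0 \/ (0 <= c1 j /\ 0 <= c2 j).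
Proof.
move=> t0; case: stat => _ _ /(_ j) + _ [/(_ j) + /(_ j)].
rewrite !inE /c1 /c2 /net_multiplier.
move: (component F1 j x) (component F2 j x) => a b zE n1 n2.
have [a0|a0] := eqVneq a 0.
  right; rewrite a0 (lt_eqF t0) (lt_gtF t0) !andbF !subr0.
  by split; [apply: n1; rewrite a0|case: ifP].
left; have [b0|b0] := eqVneq b 0.
  by rewrite b0 (lt_eqF t0) (lt_gtF t0) !andbF !subr0 mul0r.
have [at_|at_] /= := eqVneq a t; last by rewrite !subr0 mul0r.
have [bt|bt] /= := eqVneq b t; last by rewrite !subr0 mulr0.
rewrite bt at_ ltxx !subr0 !sub0r mulrNN.
by case: zE; rewrite ?at_ ?bt ?eqxx.
Qed.

End MultiplierPair.

(** * Passage to the limit and signs of the multipliers *)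

Theorem corollary1 (R : realType) (n kappa : nat)
    (f : 'rV[R]_n -> R) (F1 F2 : 'rV[R]_n -> 'rV[R]_kappa)
    (hf : is_C 2 f) (hF1 : is_C 2 F1) (hF2 : is_C 2 F2)
    (t : nat -> R) (t_gt0 : forall k, 0 < t k)
    (t_cvg : (t k @[k --> \oo] --> (0 : R))%classic)
    (x : nat -> 'rV[R]_n) (xbar : 'rV[R]_n)
    (zeta1 zeta2 eta1 eta2 nu1 nu2 : nat -> 'I_kappa -> R)
    (x_M_stationary : forall k, M_stationary_with f F1 F2 (t k) (x k)
       (zeta1 k) (zeta2 k) (eta1 k) (eta2 k) (nu1 k) (nu2 k))
    (x_cvg : (x k @[k --> \oo] --> xbar)%classic)
    (xbar_feasible : MPCC_feasible F1 F2 xbar)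
    (xbar_LICQ : MPCC_LICQ F1 F2 xbar)
    (xbar_ND2 : MPCC_ND2 f F1 F2 xbar) :
  S_stationary f F1 F2 xbar.
Proof.
pose c1 k j := net_multiplier (t k) (component F1 j (x k)) (component F2 j (x k))
  (zeta1 k j) (eta1 k j) (nu1 k j).
pose c2 k j := net_multiplier (t k) (component F2 j (x k)) (component F1 j (x k))
  (zeta2 k j) (eta2 k j) (nu2 k j).
(* By feasibility, [A1] and [A2] are exactly the indices where [F1], respectively [F2], vanishes at
   [xbar]. *)
pose A1 := (a01 F1 F2 xbar :|: a00 F1 F2 xbar)%SET.
pose A2 := (a10 F1 F2 xbar :|: a00 F1 F2 xbar)%SET.
have active1 j : j \notin A1 -> 0 < component F1 j xbar.
  have [p0 p1 p2] := xbar_feasible j.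
  by rewrite !inE !lt_def p1 p2 !andbT -andb_orr orNb andbT.
have active2 j : j \notin A2 -> 0 < component F2 j xbar.
  have [p0 p1 p2] := xbar_feasible j.
  by rewrite !inE !lt_def p1 p2 !andbT -andb_orl orNb.
have above_t (F : 'rV[R]_n -> 'rV[R]_kappa) j : is_C 2 F ->
    0 < component F j xbar -> (\forall k \near \oo, t k < component F j (x k))%classic.
  move=> FC Fj0.
  have Ft :
      (component F j (x k) - t k @[k --> \oo] --> component F j xbar)%classic.
    have Fx := component_cvg (j := j) FC x_cvg.
    by have := cvgB Fx t_cvg; rewrite subr0; apply.
  by apply: filterS (cvgr_gt _ Ft _ Fj0) => k; rewrite subr_gt0.
(* The sum type merges both gradient families into the single list of MPCC-LICQ, keeping the two
   copies of a biactive index apart. *)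
pose s := [seq inl j | j <- enum A1] ++ [seq inr j | j <- enum A2].
pose v y (i : 'I_kappa + 'I_kappa) := match i with
  inl j => grad (component F1 j) y | inr j => grad (component F2 j) y end.
pose c k (i : 'I_kappa + 'I_kappa) := match i with
  inl j => c1 k j | inr j => c2 k j end.
have sumE a w : \sum_(i <- s) a i *: w i =
    \sum_(j in A1) a (inl j) *: w (inl j) + \sum_(j in A2) a (inr j) *: w (inr j)
    :> 'rV[R]_n.
  by rewrite big_cat !big_map !big_enum.
have v_free : free [seq v xbar i | i <- s] by rewrite map_cat -!map_comp.
have v_cvg i : cvg_entries (fun k => v (x k) i) (v xbar i).
  by case: i => j; apply: grad_component_cvg x_cvg; eassumption.
have gradE : (\forall k \near \oo,
    grad f (x k) = \sum_(i <- s) c k i *: v (x k) i)%classic.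
  have near1 : (\forall k \near \oo, forall j,
      j \notin A1 -> t k < component F1 j (x k))%classic.
    apply: filter_forall => j; have [jA|jA] := boolP (j \in A1).
      exact: nearW.
    by apply: filterS (above_t _ _ hF1 (active1 _ jA)) => k ? _.
  have near2 : (\forall k \near \oo, forall j,
      j \notin A2 -> t k < component F2 j (x k))%classic.
    apply: filter_forall => j; have [jA|jA] := boolP (j \in A2).
      exact: nearW.
    by apply: filterS (above_t _ _ hF2 (active2 _ jA)) => k ? _.
  apply: filterS2 near1 near2 => k k1 k2.
  rewrite (M_stationary_grad (x_M_stationary k)) sumE.
  by congr (_ + _); apply/esym/big_rmcond => j jA;
     rewrite /= /c1 /c2 net_multiplier_inactive ?scale0r //; auto.
have [cb c_cvg gradbE] := free_coeffs_cvg v_free v_cvg (grad_cvg hf x_cvg) gradE.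
have a00P j : j \in a00 F1 F2 xbar -> (inl j \in s) && (inr j \in s).
  move=> j0; by rewrite !mem_cat !map_f ?orbT // mem_enum inE j0 orbT.
have cvg1 j : j \in a00 F1 F2 xbar -> (c1 k j @[k --> \oo] --> cb (inl j))%classic.
  by move=> /a00P/andP[js _]; exact: c_cvg js.
have cvg2 j : j \in a00 F1 F2 xbar -> (c2 k j @[k --> \oo] --> cb (inr j))%classic.
  by move=> /a00P/andP[_ js]; exact: c_cvg js.
have cvg12 j : j \in a00 F1 F2 xbar ->
    (c1 k j * c2 k j @[k --> \oo] --> cb (inl j) * cb (inr j))%classic.
  by move=> j0; apply: cvgM; [exact: cvg1|exact: cvg2].
(* The same limits serve as [sigma] and [rho], since [a00] is disjoint from [a01] and from [a10]. *)
have stat : C_stationary_with f F1 F2 xbar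
    (cb \o inl) (cb \o inr) (cb \o inl) (cb \o inr).
  split=> //.
    rewrite gradbE sumE big_split /= addrACA.
    have sumU (A B : {set 'I_kappa}) (F : 'I_kappa -> 'rV[R]_n) : [disjoint A & B] ->
        \sum_(j in (A :|: B)%SET) F j = \sum_(j in A) F j + \sum_(j in B) F j.
      by move=> AB; rewrite -bigU //; apply: eq_bigl => j; rewrite !inE.
    rewrite !sumU //.
      apply/pred0P => j; rewrite /= !inE.
      by case: (eqVneq (component F1 j xbar)) => [->|]; rewrite ?ltxx ?andbF.
    apply/pred0P => j; rewrite /= !inE.
    by case: (eqVneq (component F2 j xbar)) => [->|]; rewrite ?ltxx ?andbF.
  move=> j j0.
  apply: (cvgr_to_ge (cvg12 j j0)); apply: nearW => k /=.
  have [->//|[? ?]] := net_multiplier_pair (x_M_stationary k) j (t_gt0 k).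
  exact: mulr_ge0.
exists (cb \o inl), (cb \o inr), (cb \o inl), (cb \o inr); split=> // j j0.
(* MPCC-ND2 applies to the limits thanks to [stat]; a positive limit product makes [c1 k j * c2 k j]
   eventually positive, which excludes the zero-product case. *)
have nonneg : (\forall k \near \oo, 0 <= c1 k j /\ 0 <= c2 k j)%classic.
  apply: filterS (cvgr_gt _ (cvg12 j j0) _ (xbar_ND2 _ _ _ _ stat _ j0)) => k /=.
  have [->|//] := net_multiplier_pair (x_M_stationary k) j (t_gt0 k).
  by rewrite ltxx.
split.
  by apply: (cvgr_to_ge (cvg1 j j0)); apply: filterS nonneg => k [].
by apply: (cvgr_to_ge (cvg2 j j0)); apply: filterS nonneg => k [].
Qed.
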